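(* Let $n\geq 2$ and $m\geq 3$ be integers, with $n\geq 4$ if $m=3$ and $n\geq 3$ if $m=4$. Let $f\in\mathbb{C}[x_1,\ldots,x_n]$ be a regular homogeneous polynomial of degree $m$, and let $\varphi:=\mathrm{Hess}(f)=\det\left(\frac{\partial^2 f}{\partial x_i\partial x_j}\right)_{1\leq i,j\leq n}$, a homogeneous polynomial of degree $n(m-2)$. For $t\in\mathbb{C}$ set $g_t:=f+t\varphi$. Then for general $t\in\mathbb{C}$ (i.e. for all but finitely many $t$) the germ at the origin of $\{g_t=0\}$ is not analytically equivalent to the germ at the origin of $\{f=0\}$.
   Context: A homogeneous polynomial $f\in\mathbb{C}[x_1,\ldots,x_n]$ of degree $m$ is called regular if the hypersurface $\{f=0\}\subset\mathbb{P}^{n-1}$ is smooth (equivalently, the only common zero in $\mathbb{C}^n$ of its partial derivatives is the origin). Let $\mathcal{O}_n=\mathbb{C}\{x_1,\ldots,x_n\}$ be the ring of convergent power series. For $f,g\in\mathcal{O}_n$, the germs at the origin of $\{f=0\}$ and $\{g=0\}$ are analytically equivalent if there is a $\mathbb{C}$-algebra automorphism $\phi$ of $\mathcal{O}_n$ and a unit $u\in\mathcal{O}_n$ with $\phi(f)=u\,g$. *)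

(* Defs.v *)
From HB Require Import structures.
From mathcomp Require Import all_boot all_order all_algebra.
From mathcomp Require Import boolp reals.
From mathcomp Require Import complex mpoly.

Set Implicit Arguments.
Unset Strict Implicit.
Unset Printing Implicit Defensive.

Import Order.TTheory GRing.Theory Num.Theory.
Local Open Scope ring_scope.

Section PowerSeries.
Variables (K : numFieldType) (n : nat).
Implicit Types (a b c : 'X_{1..n} -> K) (m : 'X_{1..n}) (d : nat).

(* Absolute convergence on some polydisc of radius [r] centred at the origin:
   the partial sums of [\sum_m |a m| r ^ |m|] are bounded. *)
Definition cvg_coef a : Prop :=
  exists r M : K, 0 < r /\
    forall d, \sum_(m : 'X_{1..n < d}) `|a m| * r ^+ mdeg m <= M.

Definition cauchy_prod a b m : K :=
  \sum_(k : 'X_{1..n < (mdeg m).+1} | (k <= m)%MM) a k * b (m - k)%MM.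

Definition cps_trunc d a : {mpoly K[n]} :=
  \sum_(m : 'X_{1..n < d}) a m *: 'X_[m].

Lemma cps_truncE d a m : (mdeg m < d)%N -> (cps_trunc d a)@_m = a m.
Proof. exact: mcoeff_mpoly. Qed.

Lemma cauchy_prodE d a b m : (mdeg m < d)%N ->
  cauchy_prod a b m = (cps_trunc d a * cps_trunc d b)@_m.
Proof.
move=> md; rewrite [RHS](mcoeff_poly_mul_lin _ _ (k := (mdeg m).+1)) //.
apply: eq_bigr => k _; rewrite !cps_truncE //.
  by apply: leq_ltn_trans md; apply: mdegB.
by apply: leq_trans (bmdeg k) _.
Qed.

Lemma mcoeff_mul_trunc d p q p' q' m : (mdeg m < d)%N ->
  (forall k, (mdeg k < d)%N -> p@_k = p'@_k) ->
  (forall k, (mdeg k < d)%N -> q@_k = q'@_k) ->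
  (p * q : {mpoly K[n]})@_m = (p' * q')@_m.
Proof.
move=> md hp hq.
rewrite [LHS](mcoeff_poly_mul_lin _ _ (k := d)) // [RHS](mcoeff_poly_mul_lin _ _ (k := d)) //.
apply: eq_bigr => k _; rewrite hp ?bmdeg// hq//.
by apply: leq_ltn_trans md; apply: mdegB.
Qed.

Lemma cauchy_prodA : associative cauchy_prod.
Proof.
move=> a b c; apply/funext => m; rewrite !(cauchy_prodE _ _ (ltnSn (mdeg m))).
set d := (mdeg m).+1; have md : (mdeg m < d)%N by [].
transitivity (cps_trunc d a * (cps_trunc d b * cps_trunc d c))@_m.
  by apply: (mcoeff_mul_trunc md) => // k kd; rewrite cps_truncE // (cauchy_prodE _ _ kd).
rewrite mulrA.
by apply: (mcoeff_mul_trunc md) => // k kd; rewrite cps_truncE // (cauchy_prodE _ _ kd).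
Qed.

Lemma cauchy_prodC : commutative cauchy_prod.
Proof.
move=> a b; apply/funext => m.
by rewrite !(cauchy_prodE _ _ (ltnSn (mdeg m))) mulrC.
Qed.

Lemma partial_sum_ler (r s : K) a d : 0 < r -> r <= s ->
  \sum_(m : 'X_{1..n < d}) `|a m| * r ^+ mdeg m
    <= \sum_(m : 'X_{1..n < d}) `|a m| * s ^+ mdeg m.
Proof.
move=> r0 rs; apply: ler_sum => m _; apply: ler_wpM2l => //.
by apply: lerXn2r => //; rewrite nnegrE ltW// (lt_le_trans r0).
Qed.

Lemma cvg_coef2 a b : cvg_coef a -> cvg_coef b -> exists r M N : K, [/\ 0 < r,
  forall d, \sum_(m : 'X_{1..n < d}) `|a m| * r ^+ mdeg m <= M &
  forall d, \sum_(m : 'X_{1..n < d}) `|b m| * r ^+ mdeg m <= N].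
Proof.
move=> [r [M [r0 rM]]] [s [N [s0 sN]]].
have [rs|/ltW sr] := real_leP (gtr0_real r0) (gtr0_real s0).
  by exists r, M, N; split=> // d; apply: le_trans (partial_sum_ler _ _ r0 rs) _.
by exists s, M, N; split=> // d; apply: le_trans (partial_sum_ler _ _ s0 sr) _.
Qed.

Lemma cvg_coef0 : cvg_coef (fun=> 0).
Proof.
exists 1, 0; split=> // d; rewrite big1 // => m _.
by rewrite normr0 mul0r.
Qed.

Lemma cvg_coefD a b : cvg_coef a -> cvg_coef b -> cvg_coef (fun m => a m + b m).
Proof.
move=> ca cb; have [r [M [N [r0 aM bN]]]] := cvg_coef2 ca cb.
exists r, (M + N); split=> // d; apply: le_trans (lerD (aM d) (bN d)).
rewrite -big_split ler_sum //= => m _; rewrite -mulrDl ler_wpM2r ?ler_normD //.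
by rewrite exprn_ge0 // ltW.
Qed.

Lemma cvg_coefZ (x : K) a : cvg_coef a -> cvg_coef (fun m => x * a m).
Proof.
move=> [r [M [r0 aM]]]; exists r, (`|x| * M); split=> // d.
apply: le_trans (ler_wpM2l (normr_ge0 x) (aM d)).
by rewrite mulr_sumr; apply: ler_sum => m _; rewrite normrM mulrA.
Qed.

Lemma cvg_coefN a : cvg_coef a -> cvg_coef (fun m => - a m).
Proof.
by move=> /(cvg_coefZ (-1)); congr cvg_coef; apply/funext => m; rewrite mulN1r.
Qed.

Lemma cvg_coef_cauchy_prod a b : cvg_coef a -> cvg_coef b -> cvg_coef (cauchy_prod a b).
Proof.
move=> ca cb; have [r [M [N [r0 aM bN]]]] := cvg_coef2 ca cb.
pose A m := `|a m| * r ^+ mdeg m; pose B m := `|b m| * r ^+ mdeg m.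
have A0 m : 0 <= A m by rewrite mulr_ge0 // exprn_ge0 // ltW.
have B0 m : 0 <= B m by rewrite mulr_ge0 // exprn_ge0 // ltW.
exists r, (M * N); split=> // d.
have le1 m : `|cauchy_prod a b m| * r ^+ mdeg m <= cauchy_prod A B m.
  rewrite /cauchy_prod; apply: (le_trans (ler_wpM2r _ (ler_norm_sum _ _ _))).
    by rewrite exprn_ge0 // ltW.
  rewrite mulr_suml; apply: ler_sum => k km.
  have -> : r ^+ mdeg m = r ^+ mdeg k * r ^+ mdeg (m - k)%MM.
    by rewrite -exprD addnC -mdegD submK.
  by rewrite normrM mulrACA.
apply: (@le_trans _ _ ((\sum_(m : 'X_{1..n < d}) A m) *
                       (\sum_(m : 'X_{1..n < d}) B m))); last first.
  by apply: ler_pM => //; apply: sumr_ge0.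
apply: (@le_trans _ _ (\sum_(m : 'X_{1..n < d})
   \sum_(k : 'X_{1..n < d, d} | val m == (k.1 + k.2)%MM) A k.1 * B k.2)).
  apply: ler_sum => m _; apply: le_trans (le1 _) _.
  rewrite (cauchy_prodE _ _ (bmdeg m)) [leLHS](mcoeff_poly_mul _ _ (bmdeg m)).
  by apply: ler_sum => k _; rewrite !cps_truncE ?bmdeg.
rewrite (exchange_big_dep xpredT) //= mulr_suml.
under [leRHS]eq_bigr do rewrite mulr_sumr.
rewrite pair_bigA /=; apply: ler_sum => -[k l] _ /=.
have AB0 : 0 <= A k * B l by rewrite mulr_ge0.
have [kld|kld] := ltnP (mdeg (k + l)%MM) d.
  by rewrite (big_pred1 (BMultinom kld)).
rewrite big_pred0 // => m; apply/negP => /eqP mkl.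
by have := bmdeg m; rewrite mkl ltnNge kld.
Qed.

Lemma cvg_coef_mpoly (p : {mpoly K[n]}) : cvg_coef (fun m => p@_m).
Proof.
exists 1, (\sum_(m : 'X_{1..n < msize p}) `|p@_m|); split=> // d.
under eq_bigr do rewrite expr1n mulr1.
have cut e : \sum_(m : 'X_{1..n < e}) `|p@_m| =
    \sum_(m <- [seq val m | m : 'X_{1..n < e}] | m \in msupp p) `|p@_m|.
  rewrite [RHS]big_mkcond big_image /=; apply: eq_bigr => m _.
  by case: ifPn => // /memN_msupp_eq0 ->; rewrite normr0.
have uq e : uniq [seq val m | m : 'X_{1..n < e}].
  by rewrite map_inj_uniq ?enum_uniq //; apply: val_inj.
rewrite [leLHS]cut [leRHS]cut -2!(big_filter _ (mem (msupp p))).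
set s := filter _ _; set t := filter _ _.
have st : {subset s <= t}.
  move=> m; rewrite !mem_filter => /andP[/= mp _]; rewrite mp /=.
  by apply/mapP; exists (BMultinom (msize_mdeg_lt mp)); rewrite ?mem_enum.
rewrite [leRHS](bigID (mem s)) /= -[leLHS]addr0 lerD ?sumr_ge0 //.
rewrite -[X in _ <= X]big_filter.
rewrite (perm_big [seq m <- t | m \in s]) //.
apply: uniq_perm; rewrite ?filter_uniq ?uq // => m.
by rewrite mem_filter; case ms: (m \in s); rewrite //= st.
Qed.

Record cpseries := CPSeries {
  cpcoef :> 'X_{1..n} -> K;
  cpcoefP : cvg_coef cpcoef }.

Lemma cpseriesP (F G : cpseries) : cpcoef F = cpcoef G <-> F = G.
Proof.
split=> [|-> //]; case: F G => [a ca] [b cb] /= ab.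
by move: ca cb; rewrite ab => ca cb; congr CPSeries; apply: Prop_irrelevance.
Qed.

Implicit Types F G H : cpseries.

HB.instance Definition _ := gen_eqMixin cpseries.
HB.instance Definition _ := gen_choiceMixin cpseries.

Definition mpoly_cps (p : {mpoly K[n]}) : cpseries :=
  CPSeries (cvg_coef_mpoly p).

Definition cps_add F G := CPSeries (cvg_coefD (cpcoefP F) (cpcoefP G)).
Definition cps_opp F := CPSeries (cvg_coefN (cpcoefP F)).
Definition cps_scale (x : K) F := CPSeries (cvg_coefZ x (cpcoefP F)).
Definition cps_mul F G := CPSeries (cvg_coef_cauchy_prod (cpcoefP F) (cpcoefP G)).

Lemma cps_addA : associative cps_add.
Proof.
by move=> F G H; apply/cpseriesP/funext => m /=; rewrite addrA.
Qed.

Lemma cps_addC : commutative cps_add.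
Proof. by move=> F G; apply/cpseriesP/funext => m /=; rewrite addrC. Qed.

Lemma cps_add0 : left_id (CPSeries cvg_coef0) cps_add.
Proof. by move=> F; apply/cpseriesP/funext => m /=; rewrite add0r. Qed.

Lemma cps_addN : left_inverse (CPSeries cvg_coef0) cps_opp cps_add.
Proof. by move=> F; apply/cpseriesP/funext => m /=; rewrite addNr. Qed.

HB.instance Definition _ :=
  GRing.isZmodule.Build cpseries cps_addA cps_addC cps_add0 cps_addN.

Lemma cps_mulA : associative cps_mul.
Proof. by move=> F G H; apply/cpseriesP; apply: cauchy_prodA. Qed.

Lemma cps_mulC : commutative cps_mul.
Proof. by move=> F G; apply/cpseriesP; apply: cauchy_prodC. Qed.

Lemma cps_mul1 : left_id (mpoly_cps 1) cps_mul.
Proof.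
move=> F; apply/cpseriesP/funext => m /=.
have md := ltnSn (mdeg m); rewrite (cauchy_prodE _ _ md) -[RHS](cps_truncE _ md).
rewrite -[X in _ = X@__]mul1r; apply: (mcoeff_mul_trunc md) => // k kd.
by rewrite cps_truncE.
Qed.

Lemma cps_mulDl : left_distributive cps_mul +%R.
Proof.
move=> F G H; apply/cpseriesP/funext => m /=; rewrite /cauchy_prod -big_split /=.
by apply: eq_bigr => k _; rewrite mulrDl.
Qed.

Lemma cps_oner_neq0 : mpoly_cps 1 != 0.
Proof.
apply/eqP => /cpseriesP /(congr1 (fun a => a 0%MM)) /=.
by rewrite mcoeff1 eqxx => /eqP; rewrite oner_eq0.
Qed.

HB.instance Definition _ := GRing.Zmodule_isComNzRing.Build cpseries
  cps_mulA cps_mulC cps_mul1 cps_mulDl cps_oner_neq0.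

Lemma cps_scaleA (x y : K) F : cps_scale x (cps_scale y F) = cps_scale (x * y) F.
Proof. by apply/cpseriesP/funext => m /=; rewrite mulrA. Qed.

Lemma cps_scale1 : left_id 1 cps_scale.
Proof. by move=> F; apply/cpseriesP/funext => m /=; rewrite mul1r. Qed.

Lemma cps_scaleDr : right_distributive cps_scale +%R.
Proof. by move=> x F G; apply/cpseriesP/funext => m /=; rewrite mulrDr. Qed.

Lemma cps_scaleDl F : {morph cps_scale^~ F : x y / x + y}.
Proof. by move=> x y; apply/cpseriesP/funext => m /=; rewrite mulrDl. Qed.

HB.instance Definition _ := GRing.Zmodule_isLmodule.Build K cpseries
  cps_scaleA cps_scale1 cps_scaleDr cps_scaleDl.

Lemma cps_scaleAl (x : K) F G : x *: (F * G) = (x *: F) * G.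
Proof.
apply/cpseriesP/funext => m /=; rewrite /cauchy_prod mulr_sumr.
by apply: eq_bigr => k _; rewrite mulrA.
Qed.

HB.instance Definition _ :=
  GRing.Lmodule_isLalgebra.Build K cpseries cps_scaleAl.
HB.instance Definition _ := GRing.Lalgebra_isComAlgebra.Build K cpseries.

(* The inverse is selected classically, so that [F \is a GRing.unit] holds
   exactly when [F] has an inverse among the convergent series. *)
Definition cps_unit : {pred cpseries} := fun F => `[< exists G, G * F = 1 >].

Definition cps_inv F : cpseries :=
  if pselect (exists G, G * F = 1) is left FV then projT1 (cid FV) else F.

Lemma cps_mulV : {in cps_unit, left_inverse 1 cps_inv *%R}.
Proof.
move=> F /asboolP FV; rewrite /cps_inv; case: pselect => // FV'.
exact: projT2 (cid FV').
Qed.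

Lemma cps_unitPl F G : G * F = 1 -> cps_unit F.
Proof. by move=> GF; apply/asboolP; exists G. Qed.

Lemma cps_inv_out : {in [predC cps_unit], cps_inv =1 id}.
Proof.
move=> F /asboolPn nFV; rewrite /cps_inv; case: pselect => // FV.
Qed.

HB.instance Definition _ := GRing.ComNzRing_hasMulInverse.Build cpseries
  cps_mulV cps_unitPl cps_inv_out.

(* The germs at the origin of [F = 0] and [G = 0] are analytically equivalent;
   [{lrmorphism _ -> _}] is the type of K-algebra morphisms. *)
Definition analytically_equivalent F G : Prop :=
  exists2 phi : {lrmorphism cpseries -> cpseries}, bijective phi &
    exists2 u : cpseries, u \is a GRing.unit & phi F = u * G.

End PowerSeries.

Section Polynomials.
Variables (K : fieldType) (n : nat).

(* Smoothness of the projective hypersurface [f = 0] by the Jacobian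
   criterion, on homogeneous coordinates; [K] is meant to be algebraically
   closed, so that its closed points are these K-rational ones. *)
Definition smooth_hypersurface (f : {mpoly K[n]}) : Prop :=
  forall x : 'I_n -> K, (exists i, x i != 0) -> f.@[x] = 0 ->
    exists i, f^`M(i).@[x] != 0.

Definition Hess (f : {mpoly K[n]}) : {mpoly K[n]} :=
  \det (\matrix_(i, j) f^`M(i)^`M(j)).

End Polynomials.

(* Main.v *)
(** Write H for the Hessian of f, k = m - 2, and T(p) for the ideal of convergent
    series generated by p and its partial derivatives; an analytic equivalence
    carries T(g_t) onto T(f), and it preserves the order filtration.

    Since f is regular, some power of every x_i lies in the Jacobian ideal J of f
    (Nullstellensatz), say x^N = A (grad f).  By Euler's formula
    (m - 1) grad f = Hess(f) x, so A Hess(f) takes x to (m - 1) x^N and its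
    determinant is congruent to c x_1^(N-1) ... x_n^(N-1) modulo
    (x_1^N, ..., x_n^N), with c <> 0.  If H were in J, then by Cramer's rule
    det(A) H would lie in (x_1^N, ..., x_n^N), which is absurd; so H is not in J.

    On the other hand Euler's formula for f and H puts t (nk - m) H in T(g_t),
    where nk <> m by the assumptions on n and m.  Modulo series of order > nk the
    ideal T(g_t) contains H and the multiples of the partial derivatives of
    f + t H; the span of these has, for general t, at least the dimension it has
    at t = 0, which is one more than the dimension of T(f) = J. *)

Require Import Defs.
From HB Require Import structures.
From mathcomp Require Import all_boot all_order all_algebra.
From mathcomp Require Import boolp classical_sets reals.
From mathcomp Require Import complex mpoly.
Import Order.TTheory GRing.Theory Num.Theory.
Local Open Scope ring_scope.

Set Implicit Arguments.
Unset Strict Implicit.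
Unset Printing Implicit Defensive.

(** * Nullstellensatz over an uncountable field *)

(** Pigeonhole form: every map to [nat] has an infinite fibre. It agrees with the usual notion
    because a countable union of finite sets is countable. *)
Definition uncountable (T : eqType) := forall w : T -> nat,
  exists k, forall N, exists s : seq T,
    [/\ uniq s, size s = N & {in s, forall x, w x = k}].

Lemma avoid_seq (R : realFieldType) (s : seq R) (a b : R) : a < b ->
  exists a' b', [/\ a <= a', a' < b', b' <= b &
    {in s, forall x, ~~ (a' <= x <= b')}].
Proof.
elim: s a b => [|x s IH] a b ab; first by exists a, b.
have [a1 [b1 [aa1 ab1 bb1 sx]]] := IH _ _ ab.
have [x_lt|x_ge] := ltP x ((a1 + b1) / 2).
  have h : (a1 + b1) / 2 < b1 by rewrite midf_lt.
  exists ((a1 + b1) / 2), b1; split=> // [|y].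
    by rewrite (le_trans aa1) // ltW // midf_lt.
  rewrite inE => /predU1P[->|/sx]; first by rewrite leNgt x_lt.
  apply: contra => /andP[h1 ->]; rewrite andbT (le_trans _ h1) //.
  by rewrite ltW // midf_lt.
(* Here [x] may be the midpoint itself, so only the left quarter is kept. *)
have h : a1 < (a1 + (a1 + b1) / 2) / 2 by rewrite midf_lt // midf_lt.
have h' : (a1 + (a1 + b1) / 2) / 2 < (a1 + b1) / 2 by rewrite midf_lt // midf_lt.
exists a1, ((a1 + (a1 + b1) / 2) / 2); split=> // [|y].
  by rewrite (le_trans _ bb1) // ltW // (lt_trans h') // midf_lt.
rewrite inE => /predU1P[->|/sx].
  by rewrite negb_and -!ltNge (lt_le_trans h') // orbT.
apply: contra => /andP[-> /= h1]; rewrite (le_trans h1) //.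
by rewrite ltW // (lt_trans h') // midf_lt.
Qed.

Lemma not_infinite_seq (T : eqType) (P : T -> Prop) (N : nat) :
  ~ (exists s : seq T, [/\ uniq s, size s = N & {in s, forall x, P x}]) ->
  exists s : seq T, forall x, P x -> x \in s.
Proof.
elim: N => [|N IH] h; first by case: h; exists [::].
have [[s [us sN sP]]|/IH//] :=
  pselect (exists s : seq T, [/\ uniq s, size s = N & {in s, forall x, P x}]).
exists s => x Px; apply/negP => /negP xs; apply: h; exists (x :: s); split=> /=.
- by rewrite xs.
- by rewrite sN.
- by move=> y; rewrite inE => /predU1P[->|/sP].
Qed.

(** Cantor's nested intervals: if all fibres of [w] were finite, intervals avoiding one fibre after
    another would still share a point [x], which lies in the fibre over [w x]. *)
Lemma real_uncountable (R : realType) : uncountable R.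
Proof.
move=> w; apply: contrapT => /forallNP H.
have /choice[L Lw] : forall k, exists s : seq R, forall x, w x = k -> x \in s.
  by move=> k; have /existsNP[N hN] := H k; exact: (not_infinite_seq hN).
have /choice[step stepP] : forall kab : nat * (R * R), exists ab' : R * R,
    kab.2.1 < kab.2.2 -> [/\ kab.2.1 <= ab'.1, ab'.1 < ab'.2, ab'.2 <= kab.2.2 &
      {in L kab.1, forall x, ~~ (ab'.1 <= x <= ab'.2)}].
  move=> [k [a b]] /=; have [ab|_] := ltP a b; last by exists (a, b).
  by have [a' [b' h]] := avoid_seq (L k) ab; exists (a', b').
pose I := fix I k := if k is j.+1 then step (j, I j) else (0, 1) : R * R.
have I_lt k : (I k).1 < (I k).2.
  by elim: k => [|k /(stepP (k, I k))[]//]; rewrite /= ltr01.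
have I_le j k : (j <= k)%N -> (I j).1 <= (I k).1 /\ (I k).2 <= (I j).2.
  move=> /subnK <-; elim: (k - j)%N => [|i [IH1 IH2]]; first by rewrite !lexx.
  have [h1 _ h2 _] := stepP ((i + j)%N, I (i + j)%N) (I_lt _).
  by split; [apply: le_trans IH1 h1 | apply: le_trans h2 IH2].
have I_cross j k : (I j).1 <= (I k).2.
  have [h1 _] := I_le j (maxn j k) (leq_maxl _ _).
  have [_ h2] := I_le k (maxn j k) (leq_maxr _ _).
  exact: le_trans h1 (le_trans (ltW (I_lt _)) h2).
pose A : set R := fun x => exists k, x = (I k).1.
have A0 : nonempty A by exists (I 0%N).1, 0%N.
have Aub k : ubound A (I k).2 by move=> _ [j ->].
have As : has_sup A by split=> //; exists (I 0%N).2; apply: Aub.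
pose x := sup A.
have [_ _ _ /(_ x (Lw _ x erefl)) hx] := stepP (w x, I (w x)) (I_lt _).
have /negP := hx; apply; rewrite -[step _]/(I (w x).+1); apply/andP; split.
  by apply: ub_le_sup; [case: As | exists (w x).+1].
by apply: ge_sup A0 _; exact: Aub.
Qed.

Lemma complex_uncountable (R : realType) : uncountable R[i].
Proof.
move=> w; have [k hk] := real_uncountable (fun x : R => w x%:C%C).
exists k => N; have [s [us sN sw]] := hk N.
exists [seq x%:C%C | x <- s]; split; rewrite ?size_map //.
  by rewrite map_inj_uniq // => x y [].
by move=> _ /mapP[x /sw wx ->].
Qed.

Section Ideals.
Variable A : comNzRingType.
Implicit Types (I : A -> Prop) (p q : A).

Definition is_ideal I :=
  [/\ I 0, forall p q, I p -> I q -> I (p + q) & forall a p, I p -> I (a * p)].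

Definition adjoin I q p := exists a b, I a /\ p = a + b * q.

Lemma adjoin_ideal I q : is_ideal I -> is_ideal (adjoin I q).
Proof.
move=> [I0 ID IM]; split; first by exists 0, 0; rewrite mul0r addr0.
  move=> _ _ [a1 [b1 [h1 ->]]] [a2 [b2 [h2 ->]]].
  by exists (a1 + a2), (b1 + b2); split; [exact: ID|rewrite mulrDl addrACA].
move=> c _ [a [b [h ->]]]; exists (c * a), (c * b).
by split; [exact: IM|rewrite mulrDr mulrA].
Qed.

Lemma sub_adjoin I q p : I p -> adjoin I q p.
Proof. by exists p, 0; rewrite mul0r addr0. Qed.

Lemma mem_adjoin I q : is_ideal I -> adjoin I q q.
Proof. by move=> [I0 _ _]; exists 0, 1; rewrite mul1r add0r. Qed.

Lemma ideal_opp I p : is_ideal I -> I p -> I (- p).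
Proof. by move=> [_ _ IM] /(IM (-1)); rewrite mulN1r. Qed.

Lemma ideal_sum I (J : Type) (r : seq J) (P : pred J) (F : J -> A) :
  is_ideal I -> (forall j, P j -> I (F j)) -> I (\sum_(j <- r | P j) F j).
Proof. by move=> [I0 ID _] IF; apply: (big_ind I). Qed.

Lemma ideal_prodB1 I (J : eqType) (r : seq J) (F : J -> A) :
  is_ideal I -> (forall j, I (F j - 1)) -> I (\prod_(j <- r) F j - 1).
Proof.
move=> II IF; have [I0 ID IM] := II; elim: r => [|j r IH].
  by rewrite big_nil subrr.
rewrite big_cons -(subrK (\prod_(i <- r) F i) (F j * _)) -addrA.
by apply: ID IH; rewrite -{2}[\prod_(_ <- _) _]mul1r -mulrBl mulrC; apply: IM.
Qed.

Definition ideal_gen (r : nat) (F : 'I_r -> A) p :=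
  exists b : 'I_r -> A, p = \sum_j b j * F j.

Lemma ideal_gen_ideal r (F : 'I_r -> A) : is_ideal (ideal_gen F).
Proof.
split; first by exists (fun=> 0); rewrite big1 // => j _; rewrite mul0r.
  move=> _ _ [b ->] [c ->]; exists (fun j => b j + c j).
  by rewrite -big_split; apply: eq_bigr => j _; rewrite mulrDl.
move=> a _ [b ->]; exists (fun j => a * b j).
by rewrite mulr_sumr; apply: eq_bigr => j _; rewrite mulrA.
Qed.

Lemma mem_ideal_gen r (F : 'I_r -> A) j : ideal_gen F (F j).
Proof.
exists (fun i => (i == j)%:R); rewrite (bigD1 j) //= eqxx mul1r big1 ?addr0 //.
by move=> i /negPf ->; rewrite mul0r.
Qed.

End Ideals.

(** The coefficient matrix has one column per monomial of degree less than [k] and more rows than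
    columns. *)
Lemma mpoly_dependent (K : fieldType) (n : nat) (s : seq K) (h : K -> {mpoly K[n]})
    (k : nat) :
  (#|{: 'X_{1..n < k}}| < size s)%N ->
  {in s, forall c, (msize (h c) <= k)%N} ->
  exists2 l : 'I_(size s) -> K, exists j, l j != 0 &
    \sum_j l j *: h s`_j = 0.
Proof.
move=> sk hk; set D := #|_| in sk.
pose M := \matrix_(j < size s, e < D) (h s`_j)@_(enum_val e : 'X_{1..n < k}).
have /rowV0Pn[v /sub_kermxP vM v0] : kermx M != 0.
  rewrite kermx_eq0 /row_free neq_ltn (leq_ltn_trans _ sk) //.
  exact: rank_leq_col.
exists (v 0).
  by apply/existsP; apply: contraR v0 => /existsPn v0; apply/eqP/rowP => j;
     rewrite mxE; have := v0 j; rewrite negbK => /eqP.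
apply/mpolyP => m; rewrite raddf_sum mcoeff0 /=.
have [mk|mk] := ltnP (mdeg m) k.
  transitivity ((v *m M) 0 (enum_rank (BMultinom mk))); last by rewrite vM mxE.
  by rewrite mxE; apply: eq_bigr => j _; rewrite mcoeffZ !mxE enum_rankK.
rewrite big1 // => j _; rewrite mcoeffZ memN_msupp_eq0 ?mulr0 //.
by rewrite msize_mdeg_ge // (leq_trans _ mk) // hk // mem_nth.
Qed.


Section Nullstellensatz.
Variables (K : closedFieldType) (n : nat).
Implicit Types (I : {mpoly K[n]} -> Prop) (p q : {mpoly K[n]}).

(* If every [x - c] were invertible modulo [I], with inverse [h c], then
   uncountably many of the [h c] would have the same degree, hence be linearly
   dependent; clearing denominators, a nonzero polynomial in [x] alone would lie
   in [I], and its linear factors being invertible modulo [I], so would [1]. *)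
Lemma proper_adjoin_root I p : uncountable K -> is_ideal I -> ~ I 1 ->
  exists c, ~ adjoin I (p - c%:MP) 1.
Proof.
move=> unc II I1; have [I0 ID IM] := II; apply: contrapT => /forallNP H.
have /choice[h hP] : forall c, exists h, I (h * (p - c%:MP) - 1).
  move=> c; have [a [b [Ia ab]]] := contrapT (H c).
  exists b; rewrite -opprB [X in X - _]ab addrK; exact: ideal_opp.
have [k hk] := unc (fun c => msize (h c)).
have [s [us sN sk]] := hk #|{: 'X_{1..n < k}}|.+1.
have sk' : {in s, forall c, (msize (h c) <= k)%N} by move=> c /sk ->.
have [|l [j0 lj0] hl] := mpoly_dependent _ sk'; first by rewrite sN.
pose q : {poly K} := \sum_j l j *: \prod_(i | i != j) ('X - (s`_i)%:P).
have q0 : q != 0.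
  apply/eqP => /(congr1 (horner^~ s`_j0)); rewrite horner0 horner_sum.
  rewrite (bigD1 j0) //= [X in _ + X]big1 ?addr0 => [|j jj0]; last first.
    rewrite hornerZ horner_prod (bigD1 j0) /= ?(eq_sym j0) //.
    by rewrite hornerXsubC subrr mul0r mulr0.
  rewrite hornerZ horner_prod => /eqP; rewrite mulf_eq0 (negPf lj0) /=.
  apply/negP/prodf_neq0 => i ij0; rewrite hornerXsubC subr_eq0.
  by rewrite nth_uniq // eq_sym.
have Iq : I (map_poly (@mpolyC n K) q).[p].
  have -> : (map_poly (@mpolyC n K) q).[p] =
      \sum_j l j *: \prod_(i | i != j) (p - (s`_i)%:MP).
    rewrite rmorph_sum horner_sum; apply: eq_bigr => j _ /=.
    rewrite map_polyZ rmorph_prod hornerZ horner_prod mul_mpolyC; congr (_ *: _).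
    by apply: eq_bigr => i _; rewrite /= map_polyXsubC hornerXsubC.
  (* Multiply the dependence [hl] by all the factors; modulo [I], each [h] cancels the factor that
     it inverts. *)
  have /(congr1 (fun g => g * \prod_(i < size s) (p - (s`_i)%:MP))) := hl.
  rewrite mul0r mulr_suml => hl'; rewrite -[X in I X]subr0 -[X in _ - X]hl' -sumrB.
  apply: ideal_sum => // j _.
  rewrite -scalerAl -scalerBr -mul_mpolyC; apply: (IM).
  rewrite [X in _ * X](bigD1 j) //= mulrA -[X in X - _]mul1r -mulrBl mulrC; apply: (IM).
  by rewrite -opprB; apply: ideal_opp.
have [r] := closed_field_poly_normal q.
have : lead_coef q != 0 by rewrite lead_coef_eq0.
move: (lead_coef q) => c c0 qE.
have Ir : I (\prod_(z <- r) (p - z%:MP)).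
  have -> : \prod_(z <- r) (p - z%:MP) =
      (c^-1)%:MP * (map_poly (@mpolyC n K) q).[p].
    rewrite qE map_polyZ rmorph_prod hornerZ horner_prod mulrA -mpolyCM.
    rewrite mulVf // mpolyC1 mul1r.
    by apply: eq_bigr => z _ /=; rewrite map_polyXsubC hornerXsubC.
  exact: IM.
apply: I1; have := ideal_opp II (ideal_prodB1 r II hP).
rewrite big_split /= => /(ID _ _ (IM (\prod_(z <- r) h z) _ Ir)).
by rewrite opprB addrCA subrr addr0.
Qed.

(** Weak Nullstellensatz: adjoin some ['X_i - c] for each variable in turn, keeping the ideal
    proper. Modulo the resulting [J] every [p] is congruent to its value at [x], so a nonzero value
    of some [p] in [I] would put [1] into [J]. *)
Lemma proper_ideal_zero I : uncountable K -> is_ideal I -> ~ I 1 ->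
  exists x : 'I_n -> K, forall p, I p -> p.@[x] = 0.
Proof.
move=> unc II I1.
have [x [J [IJ J1 subIJ Jx]]] : exists x : 'I_n -> K, exists J,
    [/\ is_ideal J, ~ J 1, forall p, I p -> J p &
        forall i, J ('X_i - (x i)%:MP)].
  suff H (s : seq 'I_n) : exists x : 'I_n -> K, exists J,
    [/\ is_ideal J, ~ J 1, forall p, I p -> J p &
        forall i, i \in s -> J ('X_i - (x i)%:MP)].
    have [x [J [h1 h2 h3 h4]]] := H (enum 'I_n).
    by exists x, J; split=> // i; apply: h4; rewrite mem_enum.
  elim: s => [|i s [x [J [IJ J1 subIJ Jx]]]]; first by exists (fun=> 0), I.
  have [c Jc] := proper_adjoin_root 'X_i unc IJ J1.
  exists (fun j => if j == i then c else x j), (adjoin J ('X_i - c%:MP)).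
  split=> [|//|p /subIJ /sub_adjoin //|j]; first exact: adjoin_ideal.
  rewrite inE; have [-> _|_ /= /Jx /sub_adjoin //] := eqVneq j i.
  exact: mem_adjoin.
have [J0 JD JM] := IJ.
pose E p := J (p - p.@[x]%:MP).
have EM p q : E p -> E q -> E (p * q).
  move=> Ep Eq; rewrite /E mevalM mpolyCM.
  have -> : p * q - p.@[x]%:MP * q.@[x]%:MP =
     q * (p - p.@[x]%:MP) + p.@[x]%:MP * (q - q.@[x]%:MP).
    by rewrite !mulrBr addrA [q * p]mulrC [q * _]mulrC subrK.
  by apply: JD; apply: JM.
have EC c : E c%:MP by rewrite /E mevalC subrr.
have E_all p : E p.
  elim/mpolyind: p => [|c m p _ _ Ep]; first by rewrite -mpolyC0.
  rewrite /E mevalD mpolyCD opprD addrACA; apply: (JD) Ep.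
  rewrite -mul_mpolyC; apply: (EM) => //; rewrite mpolyXE_id.
  apply: (big_ind E) => [|//|i _]; first by rewrite -mpolyC1.
  elim: (m i) => [|k IH]; first by rewrite expr0 -mpolyC1.
  by rewrite exprS; apply: (EM) IH; rewrite /E mevalXU.
exists x => p /subIJ Jp; apply/eqP/negPn/negP => px; apply: J1.
rewrite -mpolyC1 -(mulVf px) mpolyCM; apply: JM.
rewrite -[X in J X](subKr p); apply: JD Jp _; apply: ideal_opp => //; exact: E_all.
Qed.

End Nullstellensatz.

(** * Homogeneous ideals *)

Section Homogeneous.
Variables (K : fieldType) (n : nat).
Implicit Types (p q : {mpoly K[n]}).

Lemma pihomogM_homog e k p q : q \is e.-homog ->
  pihomog mdeg k (p * q) = (if (e <= k)%N then pihomog mdeg (k - e) p else 0) * q.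
Proof.
move=> hq; elim/mpolyind: p => [|c m p _ _ IH].
  by rewrite mul0r !pihomog0 if_same mul0r.
rewrite mulrDl pihomogD IH -scalerAl linearZ /=.
have -> : pihomog mdeg k ('X_[m] * q) =
    (if (e <= k)%N then pihomog mdeg (k - e) 'X_[m] else 0) * q.
  have hm : ('X_[m] * q) \is (mdeg m + e).-homog by rewrite dhomogM // dhomogX.
  have [mk|mk] := eqVneq (mdeg m + e)%N k.
    by rewrite -{1}mk pihomog_dE // -mk leq_addl addnK pihomogX eqxx.
  rewrite (pihomog_ne0 mk) //; case: leqP => ek; last by rewrite mul0r.
  rewrite pihomogX; case: eqP => [mE|_]; rewrite ?mul0r //.
  by move: mk; rewrite mE subnK // eqxx.
by case: leqP; rewrite ?mul0r ?scaler0 ?addr0 // pihomogD linearZ mulrDl scalerAl.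
Qed.

Lemma ideal_gen_pihomog r (F : 'I_r -> {mpoly K[n]}) e k p :
  (forall j, F j \is e.-homog) -> ideal_gen F p -> ideal_gen F (pihomog mdeg k p).
Proof.
move=> hF [b ->]; rewrite linear_sum /=.
exists (fun j => if (e <= k)%N then pihomog mdeg (k - e) (b j) else 0).
by apply: eq_bigr => j _; rewrite (pihomogM_homog _ _ (hF j)).
Qed.

Lemma pihomog_msize k p : (msize p <= k)%N -> pihomog mdeg k p = 0.
Proof.
move=> pk; rewrite pihomogE big_seq_cond big1 // => m /andP[/msize_mdeg_lt mp /eqP mk].
by move: mp; rewrite mk ltnNge pk.
Qed.

(** Compare components in a relation 1 = g + b (x_i - 1): modulo the homogeneous ideal, b_0 is
    congruent to -1 and b_(k+1) to b_k x_i. So b_k is congruent to -x_i^k, and b_k = 0 for large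
    k. *)
Lemma ideal_gen_power r (F : 'I_r -> {mpoly K[n]}) e i :
  (forall j, F j \is e.-homog) -> adjoin (ideal_gen F) ('X_i - 1%:MP) 1 ->
  exists N, ideal_gen F ('X_i ^+ N).
Proof.
move=> hF [g [b [Jg]]]; rewrite mpolyC1 mulrBr mulr1 => e1.
have [J0 JD JM] := ideal_gen_ideal F; have Jpi k := ideal_gen_pihomog k hF Jg.
have hX : ('X_i : {mpoly K[n]}) \is 1.-homog by rewrite dhomogX /= mdeg1.
have claim k : ideal_gen F (pihomog mdeg k b + 'X_i ^+ k).
  have ek k' := congr1 (pihomog mdeg k') e1.
  elim: k => [|k IH].
    have := ek 0%N; rewrite !pihomogD pihomogN (pihomogM_homog 0 b hX) /=.
    rewrite pihomog_dE ?dhomog1 // mul0r sub0r expr0 => ->.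
    by rewrite addrCA subrr addr0.
  have := ek k.+1; rewrite !pihomogD pihomogN (pihomogM_homog k.+1 b hX) /=.
  rewrite (@pihomog_ne0 _ _ _ 0%N) ?dhomog1 // subn1 /= => /eqP.
  rewrite addrA eq_sym subr_eq0 => /eqP <-; rewrite exprSr -addrA -mulrDl mulrC.
  by apply: JD => //; apply: JM.
by exists (msize b); have := claim (msize b); rewrite pihomog_msize // add0r.
Qed.

End Homogeneous.

(** * The Hessian and the Jacobian ideal *)

Section MonomialIdeal.
Variables (K : fieldType) (n N : nat).
Implicit Types (p q : {mpoly K[n]}) (S T : pred 'I_n).

(* Membership in the ideal generated by the ['X_i ^+ N] with [S i]. *)
Definition power_ideal S p :=
  forall m : 'X_{1..n}, (forall i, S i -> (m i < N)%N) -> p@_m = 0.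

Lemma power_ideal_ideal S : is_ideal (power_ideal S).
Proof.
split=> [m _|p q hp hq m hm|a p hp m hm]; first by rewrite mcoeff0.
  by rewrite mcoeffD hp // hq // addr0.
rewrite (mcoeff_poly_mul_lin _ _ (ltnSn (mdeg m))) big1 // => k km.
rewrite hp ?mulr0 // => i /hm; apply: leq_ltn_trans.
by rewrite mnmBE leq_subr.
Qed.

Lemma power_ideal_sub S T p :
  (forall i, S i -> T i) -> power_ideal S p -> power_ideal T p.
Proof. by move=> ST hp m hm; apply: hp => i /ST /hm. Qed.

Lemma power_idealXn S i : S i -> power_ideal S ('X_i ^+ N).
Proof.
move=> Si m /(_ _ Si) hm; rewrite mcoeffXn; case: eqP => // mE.
by move: hm; rewrite -mE mulmnE mnm1E eqxx mul1n ltnn.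
Qed.

Lemma power_ideal_cancelX S i p :
  ~~ S i -> power_ideal S (p * 'X_i) -> power_ideal S p.
Proof.
move=> Si hp m hm; rewrite -(mcoeffMX _ U_(i)) hp // => j Sj.
rewrite mnmDE mnm1E; case: eqP => [ij|_]; last exact: hm.
by rewrite ij Sj in Si.
Qed.

(** [Q] has the difference of the two rows as row [i0]. It maps the vector of variables into the
    ideal of powers of the other variables, so by Cramer's rule [\det Q * 'X_i0] lies there, and
    ['X_i0] is a nonzerodivisor modulo that ideal. *)
Lemma det_sub_power_ideal (A B : 'M[{mpoly K[n]}]_n) (i0 : 'I_n) :
  row' i0 A = row' i0 B -> \sum_j A i0 j * 'X_j = \sum_j B i0 j * 'X_j ->
  (forall i, i != i0 -> power_ideal (predC1 i0) (\sum_j A i j * 'X_j)) ->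
  power_ideal (predC1 i0) (\det A - \det B).
Proof.
move=> AB e0 hA.
pose Q := \matrix_(i, j) if i == i0 then A i j - B i j else A i j.
have QA : row' i0 Q = row' i0 A.
  by apply/matrixP => i j; rewrite !mxE eq_sym (negPf (neq_lift _ _)).
have -> : \det A - \det B = \det Q.
  rewrite (@determinant_multilinear _ _ Q A B i0 1 (-1)) ?mul1r ?mulN1r //.
    by apply/rowP => j; rewrite !mxE eqxx mul1r mulN1r.
  by rewrite QA.
have [I0 ID IM] := power_ideal_ideal (predC1 i0).
apply: (@power_ideal_cancelX _ i0); first by rewrite /= eqxx.
have /matrixP/(_ i0 0) : (\det Q)%:M *m (\col_j 'X_j) = \adj Q *m (Q *m \col_j 'X_j).
  by rewrite mulmxA mul_adj_mx.
rewrite mul_scalar_mx !mxE => ->; apply: ideal_sum => // i _; apply: IM.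
rewrite !mxE; have [->|ii0] := eqVneq i i0.
  have -> : \sum_j Q i0 j * (\col_j 'X_j) j 0 =
      \sum_j A i0 j * 'X_j - \sum_j B i0 j * 'X_j.
    by rewrite -sumrB; apply: eq_bigr => j _; rewrite !mxE eqxx mulrBl.
  by rewrite e0 subrr.
have -> : \sum_j Q i j * (\col_j 'X_j) j 0 = \sum_j A i j * 'X_j.
  by apply: eq_bigr => j _; rewrite !mxE (negPf ii0).
exact: hA.
Qed.

End MonomialIdeal.

(* Any two matrices expressing the [c *: 'X_i ^+ N.+1] through the variables have
   congruent determinants: exchange their rows one at a time. *)
Lemma det_power_transition (K : fieldType) (n N : nat) (c : K)
    (P : 'M[{mpoly K[n]}]_n) :
  (forall i, \sum_j P i j * 'X_j = c *: 'X_i ^+ N.+1) ->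
  power_ideal N.+1 predT (\det P - \prod_i (c *: 'X_i ^+ N)).
Proof.
move=> hP; have [I0 ID IM] := @power_ideal_ideal K n N.+1 predT.
pose D k := \matrix_(i < n, j < n)
  if (i < k)%N then (c *: 'X_i ^+ N) *+ (i == j) else P i j.
have hD k i : \sum_j D k i j * 'X_j = c *: 'X_i ^+ N.+1.
  have [ik|ki] := ltnP i k.
    rewrite (bigD1 i) //= mxE ik eqxx mulr1n -scalerAl -exprSr big1 ?addr0 //.
    by move=> j ji; rewrite mxE ik eq_sym (negPf ji) mulr0n mul0r.
  by rewrite -hP; apply: eq_bigr => j _; rewrite mxE ltnNge ki.
have step k : (k <= n)%N -> power_ideal N.+1 predT (\det P - \det (D k)).
  elim: k => [_|k IH kn].
    have -> : D 0%N = P by apply/matrixP => i j; rewrite mxE.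
    by rewrite subrr.
  have -> : \det P - \det (D k.+1) =
      (\det P - \det (D k)) + (\det (D k) - \det (D k.+1)) by rewrite addrA subrK.
  apply: (ID) (IH (ltnW kn)) _; pose i0 := Ordinal kn.
  apply: (@power_ideal_sub _ _ _ (predC1 i0)) => //.
  apply: det_sub_power_ideal; rewrite ?hD //.
    apply/matrixP => i j; rewrite !mxE /= ltnS [in RHS]leq_eqVlt.
    by have := neq_lift i0 i; rewrite -val_eqE /= eq_sym => /negPf ->.
  move=> i ii0; rewrite hD -mul_mpolyC.
  by have [_ _ IM'] := @power_ideal_ideal K n N.+1 (predC1 i0);
     apply: IM'; apply: power_idealXn.
have := step n (leqnn n); suff -> : D n = diag_mx (\row_i (c *: 'X_i ^+ N)).
  by rewrite det_diag; under eq_bigr do rewrite mxE.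
apply/matrixP => i j; rewrite !mxE ltn_ord; reflexivity.
Qed.

Lemma mderiv_euler (K : fieldType) (n k : nat) (p : {mpoly K[n]}) :
  p \is k.-homog -> \sum_i p^`M(i) * 'X_i = k%:R *: p.
Proof.
move=> /dhomogP hp; rewrite {2}[p]mpolyE scaler_sumr.
rewrite (eq_bigr (fun i => \sum_(m <- msupp p) (p@_m *: 'X_[K, m])^`M(i) * 'X_i))
  => [|i _]; last first.
  by rewrite {1}[p]mpolyE linear_sum mulr_suml.
rewrite exchange_big /=; apply: eq_big_seq => m /hp mk.
transitivity (\sum_(i < n) (p@_m * (m i)%:R) *: 'X_[K, m]).
  apply: eq_bigr => i _; rewrite linearZ /= mderivX scalerA -scalerAl -mpolyXD.
  (* Truncated subtraction in the exponent is harmless: if [m i = 0] the coefficient vanishes. *)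
  have [->|mi] := eqVneq (m i) 0%N; first by rewrite mulr0 !scale0r.
  by rewrite submK // lep1mP.
by rewrite -scaler_suml -mulr_sumr -natr_sum -mdegE mk scalerA mulrC.
Qed.

Lemma mderiv_homog (K : fieldType) (n k : nat) (p : {mpoly K[n]}) i :
  p \is k.+1.-homog -> p^`M(i) \is k.-homog.
Proof.
move=> /dhomogP hp; apply/dhomogP => m; rewrite mcoeff_msupp mcoeff_deriv => mp.
have : (m + U_(i))%MM \in msupp p.
  by rewrite mcoeff_msupp; apply: contraNneq mp => ->; rewrite mul0rn.
by move=> /hp /=; rewrite mdegD mdeg1 addn1 => -[].
Qed.

Lemma Hess_homog (K : fieldType) (n k : nat) (f : {mpoly K[n]}) :
  f \is k.+2.-homog -> Hess f \is (n * k).-homog.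
Proof.
move=> hf; have -> : (n * k = \sum_(i < n) k)%N by rewrite sum_nat_const card_ord.
rewrite /Hess /determinant; apply: rpred_sum => s _.
rewrite mulr_sign; case: ifP => _; rewrite ?rpredN.
all: apply: (big_ind2 (fun (p : {mpoly K[n]}) d => p \is d.-homog))
  => [|p d q e hp hq|i _].
all: by [exact: dhomog1 | exact: dhomogM | rewrite mxE; apply/mderiv_homog/mderiv_homog].
Qed.

Definition jacobian_ideal (K : fieldType) (n : nat) (f : {mpoly K[n]}) :=
  ideal_gen (fun i => f^`M(i)).

Lemma Hess_notin_jacobian (K : numFieldType) (n k : nat) (f : {mpoly K[n]}) :
  f \is k.+2.-homog ->
  (forall i, exists N, jacobian_ideal f ('X_i ^+ N)) -> ~ jacobian_ideal f (Hess f).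
Proof.
move=> hf /choice[N0 hN0] [h hE]; pose N := (\max_i N0 i)%N.
have [J0 JD JM] := ideal_gen_ideal (fun i : 'I_n => f^`M(i)).
have /choice[A hA] i : jacobian_ideal f ('X_i ^+ N.+1).
  have le : (N0 i <= N.+1)%N by apply: leqW; exact: (@leq_bigmax _ N0).
  by rewrite -(subnK le) exprD; exact: (JM _ _ (hN0 i)).
have [I0 ID IM] := @power_ideal_ideal K n N.+1 predT.
pose AM : 'M[{mpoly K[n]}]_n := \matrix_(i, j) A i j.
pose HM : 'M[{mpoly K[n]}]_n := \matrix_(i, j) f^`M(i)^`M(j).
have hP i : \sum_j (AM *m HM) i j * 'X_j = k.+1%:R *: 'X_i ^+ N.+1.
  rewrite hA scaler_sumr; under eq_bigr do rewrite mxE mulr_suml.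
  rewrite exchange_big /=; apply: eq_bigr => l _; rewrite mxE scalerAr.
  rewrite -mderiv_euler ?mderiv_homog // mulr_sumr.
  by apply: eq_bigr => j _; rewrite mxE mulrA.
have detI : power_ideal N.+1 predT (\det (AM *m HM)).
  rewrite det_mulmx -[\det HM]/(Hess f) hE mulr_sumr.
  apply: ideal_sum => // j _; rewrite mulrCA; apply: (IM).
  have /matrixP/(_ j 0) : (\det AM)%:M *m (\col_j f^`M(j)) =
      \adj AM *m (AM *m \col_j f^`M(j)) by rewrite mulmxA mul_adj_mx.
  rewrite mul_scalar_mx !mxE => ->; apply: ideal_sum => // i _; apply: (IM).
  rewrite mxE; under eq_bigr do rewrite !mxE.
  by rewrite -hA; apply: power_idealXn.
(* The monomial with all exponents [N] is outside the ideal; its coefficient in the product of the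
   diagonal entries is [k.+1%:R ^+ n], nonzero in characteristic zero. *)
pose m0 := [multinom N | i < n].
have := ID _ _ detI (ideal_opp (@power_ideal_ideal K n _ _) (det_power_transition hP)).
rewrite opprB addrCA subrr addr0 scaler_prod /= => /(_ m0).
have -> : \prod_(i < n) 'X_i ^+ N = 'X_[K, m0].
  by rewrite mpolyXE_id; apply: eq_bigr => i _; rewrite mnmE.
rewrite mcoeffZ mcoeffX eqxx mulr1 => /(_ _)/eqP/prodf_eq0 h0.
have [i _|i _] := h0; first by rewrite mnmE.
by rewrite pnatr_eq0.
Qed.

(** * Endomorphisms and derivations of convergent series *)

Section ConvergentSeries.
Variables (K : numFieldType) (n : nat).
Local Notation O := (cpseries K n).
Implicit Types (F G : O) (p q : {mpoly K[n]}) (m : 'X_{1..n}) (a b : 'X_{1..n} -> K).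

Lemma cpcoefD F G m : (F + G) m = F m + G m. Proof. by []. Qed.
Lemma cpcoefN F m : (- F) m = - F m. Proof. by []. Qed.
Lemma cpcoefZ (x : K) F m : (x *: F) m = x * F m. Proof. by []. Qed.

Lemma cpcoef_sum (J : Type) (r : seq J) (P : pred J) (F : J -> O) m :
  (\sum_(j <- r | P j) F j) m = \sum_(j <- r | P j) F j m.
Proof. by elim/big_rec2: _ => // j x y _ <-. Qed.

Lemma cpsP F G : (forall m, F m = G m) -> F = G.
Proof. by move=> FG; apply/cpseriesP/funext. Qed.

Lemma mpoly_cps_is_linear : linear (@mpoly_cps K n).
Proof. by move=> x p q; apply: cpsP => m; rewrite /= mcoeffD mcoeffZ. Qed.

HB.instance Definition _ := GRing.isLinear.Build K {mpoly K[n]} O _ (@mpoly_cps K n)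
  mpoly_cps_is_linear.

(** A coefficient of a product involves only coefficients of no larger degree, so computations with
    series reduce to polynomials. *)
Lemma cpcoefM_mpoly F G p q m :
  (forall k, (mdeg k <= mdeg m)%N -> F k = p@_k) ->
  (forall k, (mdeg k <= mdeg m)%N -> G k = q@_k) -> (F * G) m = (p * q)@_m.
Proof.
move=> hF hG; rewrite [LHS](cauchy_prodE _ _ (ltnSn _)).
by apply: (mcoeff_mul_trunc (ltnSn _)) => k kd; rewrite cps_truncE // (hF, hG).
Qed.

Lemma mpoly_cps_is_monoid_morphism : monoid_morphism (@mpoly_cps K n).
Proof. by split=> // p q; apply: cpsP => m; rewrite (cpcoefM_mpoly (p := p) (q := q)). Qed.

HB.instance Definition _ := GRing.isMonoidMorphism.Build {mpoly K[n]} O (@mpoly_cps K n)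
  mpoly_cps_is_monoid_morphism.

Lemma mpoly_cps_subC p (c : K) : mpoly_cps (p - c%:MP) = mpoly_cps p - c *: 1.
Proof. by apply: cpsP => m; rewrite /= mcoeffB mcoeffC mcoeff1. Qed.

Lemma cpcoefMX F i m :
  (F * mpoly_cps 'X_i) m = if m i is 0%N then 0 else F (m - U_(i))%MM.
Proof.
rewrite (@cpcoefM_mpoly _ _ (cps_trunc (mdeg m).+1 F) 'X_i) //; last first.
  by move=> k km; rewrite cps_truncE.
case mi: (m i) => [|c].
  have [_ _ IM] := @power_ideal_ideal K n 1 (pred1 i).
  apply: (IM _ _ (@power_idealXn K n 1 (pred1 i) i _)) => [|j /eqP->//] /=.
    by rewrite eqxx.
  by rewrite mi.
have le : (U_(i) <= m)%MM by rewrite lep1mP mi.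
rewrite -{1}(submK le) addmC mcoeffMX cps_truncE // ltnS; exact: mdegB.
Qed.

Lemma sum_shift_le (d : nat) i (g : 'X_{1..n} -> K) : (forall m, 0 <= g m) ->
  \sum_(m : 'X_{1..n < d}) g (m + U_(i))%MM <= \sum_(m : 'X_{1..n < d.+1}) g m.
Proof.
move=> g0; have hd (m : 'X_{1..n < d}) : (mdeg (m + U_(i))%MM < d.+1)%N.
  by rewrite mdegD mdeg1 addn1 ltnS bmdeg.
pose h (m : 'X_{1..n < d}) := BMultinom (hd m).
have hI : injective h.
  by move=> x y /(congr1 val) /= /addIm; apply: val_inj.
rewrite [leRHS](bigID (mem (codom h))) /= -[leLHS]addr0 lerD ?sumr_ge0 //.
rewrite -big_uniq; last by rewrite /codom /image_mem map_inj_uniq ?enum_uniq.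
rewrite big_map big_enum /=.
by apply: ler_sum.
Qed.

(** Halving the radius absorbs the factor [2 ^+ mdeg m], and the shift costs a factor [r^-1]. The
    bound serves both division by a variable and differentiation. *)
Lemma cvg_coef_shift i a b : cvg_coef a ->
  (forall m, `|b m| <= `|a (m + U_(i))%MM| * 2 ^+ mdeg m) -> cvg_coef b.
Proof.
move=> [r [M [r0 aM]]] ab; exists (r / 2), (r^-1 * M); split=> [|d].
  by rewrite divr_gt0.
apply: le_trans (ler_wpM2l _ (aM d.+1)); last by rewrite invr_ge0 ltW.
pose g m := `|a m| * r ^+ mdeg m.
have g0 m : 0 <= g m by rewrite mulr_ge0 // exprn_ge0 // ltW.
apply: le_trans (ler_wpM2l _ (sum_shift_le d i g0)); last by rewrite invr_ge0 ltW.
rewrite mulr_sumr; apply: ler_sum => m _.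
apply: (@le_trans _ _ (`|a (m + U_(i))%MM| * 2 ^+ mdeg m * (r / 2) ^+ mdeg m)).
  by apply: ler_wpM2r => //; rewrite exprn_ge0 // divr_ge0 // ltW.
rewrite -mulrA -exprMn mulrCA divff ?pnatr_eq0 // mulr1 /g mdegD mdeg1 addn1 exprS.
by rewrite [leRHS]mulrCA mulKf // gt_eqF.
Qed.

(** This is the geometric series in x_i / c: the test selects the pure powers of x_i. At radius |c|
    / 2 its partial sums are at most 2. *)
Lemma cvg_coef_geometric i (c : K) : c != 0 ->
  cvg_coef (fun m => if m == (U_(i) *+ mdeg m)%MM then c ^- mdeg m else 0).
Proof.
move=> c0; have c1 : 0 < `|c| by rewrite normr_gt0.
exists (`|c| / 2), 2; split=> [|d]; first by rewrite divr_gt0.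
rewrite (bigID (fun m : 'X_{1..n < d} => (m : 'X_{1..n}) == (U_(i) *+ mdeg m)%MM)) /=.
rewrite [X in _ + X]big1 ?addr0 => [|m /negPf ->]; last by rewrite normr0 mul0r.
have hd (k : 'I_d) : (mdeg (U_(i) *+ k : 'X_{1..n})%MM < d)%N.
  by rewrite mdegMn mdeg1 mul1n.
rewrite (reindex_onto (fun k => BMultinom (hd k))
    (fun m : 'X_{1..n < d} => Ordinal (bmdeg m))) /=; last first.
  by move=> m /eqP mE; apply: val_inj.
rewrite (eq_big predT (fun k : 'I_d => 2^-1 ^+ k)); last first.
- move=> k _; rewrite mdegMn mdeg1 mul1n eqxx normfV normrX exprMn mulrA mulVf ?mul1r //.
  by rewrite expf_neq0 // gt_eqF.
- move=> k; apply/andP; split; last by rewrite -val_eqE /= mdegMn mdeg1 mul1n.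
  by rewrite mdegMn mdeg1 mul1n.
have SE : 2^-1 * \sum_(k < d) 2^-1 ^+ k = 1 - 2^-1 ^+ d :> K.
  rewrite -[RHS]opprB subrX1 -mulNr opprB; congr (_ * _).
  by rewrite [X in X - _](splitr 1) mul1r addrK.
rewrite -(ler_pM2l (x := 2^-1)) ?invr_gt0 ?ltr0n // SE mulVf ?pnatr_eq0 //.
by rewrite lerBlDr lerDl exprn_ge0 // invr_ge0 ler0n.
Qed.

Lemma mpoly_cpsX_sub_unit i (c : K) : c != 0 ->
  exists G, G * mpoly_cps ('X_i - c%:MP) = 1.
Proof.
(* The inverse of x_i - c is -1/c times the geometric series in x_i / c. *)
move=> c0; pose G := CPSeries (cvg_coefZ (- c^-1) (cvg_coef_geometric i c0)).
exists G; apply: cpsP => m; rewrite mpoly_cps_subC mulrBr cpcoefD cpcoefN cpcoefMX.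
rewrite -scalerAr mulr1 cpcoefZ /= mcoeff1 !mulNr mulrN opprK mulrA divff // mul1r.
case mi: (m i) => [|k].
  have [->|m0] := eqVneq m 0%MM.
    by rewrite mdeg0 mulm0n eqxx expr0 invr1 add0r.
  rewrite add0r ifN //; apply: contraNneq m0 => mE.
  have : m i = mdeg m by rewrite {1}mE mulmnE mnm1E eqxx mul1n.
  by rewrite mi => /esym/eqP; rewrite mdeg_eq0 => ->.
have le : (U_(i) <= m)%MM by rewrite lep1mP mi.
have m0 : (m == 0)%MM = false by apply/eqP => mE; rewrite mE mnm0E in mi.
have dE : mdeg m = (mdeg (m - U_(i))%MM).+1.
  by rewrite -{1}(submK le) mdegD mdeg1 addn1.
rewrite m0; set d := mdeg (m - _)%MM in dE *.
have -> : ((m - U_(i))%MM == (U_(i) *+ d)%MM) = (m == (U_(i) *+ mdeg m)%MM).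
  by rewrite dE mulmSr -(eqm_add2r U_(i)) submK.
case: ifP => _; last by rewrite mulr0 oppr0 addr0.
by rewrite dE exprS invfM addNr.
Qed.

Definition vanish k F := forall m, (mdeg m < k)%N -> F m = 0.

Lemma vanishM j k F G : vanish j F -> vanish k G -> vanish (j + k) (F * G).
Proof.
move=> hF hG m mjk; rewrite [LHS]/(cauchy_prod F G m) /cauchy_prod.
apply: big1 => l lm; have [lj|jl] := ltnP (mdeg l) j; first by rewrite hF // mul0r.
rewrite hG ?mulr0 // -(ltn_add2l j) (leq_ltn_trans _ mjk) //.
have mE : mdeg m = (mdeg l + mdeg (m - l)%MM)%N by rewrite -mdegD addmC submK.
by apply: leq_trans (eq_leq (esym mE)); rewrite leq_add2r.
Qed.

Lemma vanish_sum k (J : Type) (r : seq J) (P : pred J) (F : J -> O) :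
  (forall j, P j -> vanish k (F j)) -> vanish k (\sum_(j <- r | P j) F j).
Proof. by move=> hF m mk; rewrite cpcoef_sum big1 // => j /hF; apply. Qed.

Lemma vanish_divX k F : vanish k.+1 F ->
  exists2 G : 'I_n -> O, forall i, vanish k (G i) & F = \sum_i G i * mpoly_cps 'X_i.
Proof.
(* [fst] chooses one variable dividing each nonconstant monomial; [g i] collects the monomials
   assigned to [i], divided by ['X_i]. *)
move=> hF; pose fst m := [pick i | m i != 0%N].
pose g i m := if fst (m + U_(i))%MM == Some i then F (m + U_(i))%MM else 0.
have hg i : cvg_coef (g i).
  apply: (cvg_coef_shift (i := i) (cpcoefP F)) => m; rewrite /g.
  case: ifP => _; last by rewrite normr0 mulr_ge0 // exprn_ge0 // ler0n.
  by rewrite ler_peMr // exprn_ege1 // ler1n.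
exists (fun i => CPSeries (hg i)) => [i m mk|].
  rewrite /= /g hF ?if_same // mdegD mdeg1 addn1 ltnS; exact: mk.
apply: cpsP => m; rewrite cpcoef_sum.
under eq_bigr do rewrite cpcoefMX /= /g.
have [[i0 fi] | fN] : (exists i, fst m = Some i) \/ fst m = None.
  by case: (fst m) => [i|]; [left; exists i | right].
  have mi0 : m i0 != 0%N by move: fi; rewrite /fst; case: pickP => // i mi [<-].
  rewrite (bigD1 i0) //= big1 ?addr0 => [|i ii0].
    case mE: (m i0) mi0 => // _; rewrite submK ?fi ?eqxx //.
    by rewrite lep1mP mE.
  case mE: (m i) => //; rewrite submK ?lep1mP ?mE // fi.
  by case: eqP => // -[ij]; rewrite ij eqxx in ii0.
have m0 : m = 0%MM.
  apply/mnmP => i; move: fN; rewrite /fst mnm0E; case: pickP => // /(_ i).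
  by move/negbFE/eqP.
rewrite big1 => [|i _]; first by rewrite hF // m0 mdeg0.
by rewrite m0 mnm0E.
Qed.

(** The image of x_i has zero constant term: were it c <> 0, the unit x_i - c would have an image
    vanishing at the origin. Splitting off one variable at a time then gives every order. *)
Lemma vanish_rmorph (phi : {lrmorphism O -> O}) k F : vanish k F -> vanish k (phi F).
Proof.
have hX i : vanish 1 (phi (mpoly_cps 'X_i)).
  move=> m; rewrite ltnS leqn0 mdeg_eq0 => /eqP ->.
  set c := phi _ _; have [//|c0] := eqVneq c 0.
  have [G GX] := mpoly_cpsX_sub_unit i c0.
  have hv : vanish 1 (phi (mpoly_cps ('X_i - c%:MP))).
    move=> m'; rewrite ltnS leqn0 mdeg_eq0 => /eqP ->.
    rewrite mpoly_cps_subC linearB cpcoefD cpcoefN -/c.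
    by rewrite linearZ rmorph1 cpcoefZ /= mcoeff1 eqxx mulr1 subrr.
  have e1 : (phi G * phi (mpoly_cps ('X_i - c%:MP))) 0%MM = 1.
    by rewrite -rmorphM GX rmorph1 /= mcoeff1 eqxx.
  have h0 : vanish 0 (phi G) by [].
  by have := vanishM h0 hv (m := 0%MM); rewrite mdeg0 e1 => /(_ isT)/eqP; rewrite oner_eq0.
elim: k F => [|k IH] F hF; first by [].
have [G hG ->] := vanish_divX hF; rewrite rmorph_sum; apply: vanish_sum => i _.
by rewrite rmorphM -addn1; exact: (vanishM (IH _ (hG i)) (hX i)).
Qed.

(** * Partial derivatives and derivations *)

Definition cps_deriv_coef i a m := a (m + U_(i))%MM *+ (m i).+1.

Lemma cvg_coef_deriv i a : cvg_coef a -> cvg_coef (cps_deriv_coef i a).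
Proof.
move=> ha; apply: (cvg_coef_shift (i := i) ha) => m.
rewrite /cps_deriv_coef normrMn -[leLHS]mulr_natr.
apply: ler_wpM2l => //; rewrite -natrX ler_nat.
apply: leq_trans (ltn_expl (m i) (ltnSn 1)) _; rewrite leq_pexp2l //.
by rewrite mdegE (bigD1 i) //= leq_addr.
Qed.

Definition cps_deriv i F : O := CPSeries (cvg_coef_deriv i (cpcoefP F)).

Lemma cps_deriv_mpoly i p : cps_deriv i (mpoly_cps p) = mpoly_cps p^`M(i).
Proof. by apply: cpsP => m; rewrite /= mcoeff_deriv. Qed.

Lemma cps_derivD i F G : cps_deriv i (F + G) = cps_deriv i F + cps_deriv i G.
Proof. by apply: cpsP => m; rewrite /= /cps_deriv_coef mulrnDl. Qed.

Lemma cps_derivZ i (x : K) F : cps_deriv i (x *: F) = x *: cps_deriv i F.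
Proof. by apply: cpsP => m; rewrite /= /cps_deriv_coef mulrnAr. Qed.

Lemma cps_derivM i F G :
  cps_deriv i (F * G) = cps_deriv i F * G + F * cps_deriv i G.
Proof.
(* A derivative at degree [mdeg m] reads the series at degree [(mdeg m).+1], so the truncation must
   keep that degree. *)
apply: cpsP => m; set d := (mdeg m).+2.
have dE k : (mdeg k <= mdeg m)%N -> (mdeg (k + U_(i))%MM < d)%N.
  by rewrite mdegD mdeg1 addn1.
have tE (H : O) k : (mdeg k < d)%N -> H k = (cps_trunc d H)@_k.
  by move=> kd; rewrite cps_truncE.
have tE' (H : O) k : (mdeg k <= mdeg m)%N -> H k = (cps_trunc d H)@_k.
  by move=> km; apply: tE; rewrite ltnS ltnW.
have dtE (H : O) k : (mdeg k <= mdeg m)%N ->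
    cps_deriv i H k = (cps_trunc d H)^`M(i)@_k.
  by move=> km; rewrite mcoeff_deriv -tE // dE.
rewrite [LHS]/= /cps_deriv_coef cpcoefD.
rewrite (cpcoefM_mpoly (dtE F) (tE' G)) (cpcoefM_mpoly (tE' F) (dtE G)).
rewrite -mcoeffD -mderivM mcoeff_deriv; congr (_ *+ _).
by apply: cpcoefM_mpoly => k km; apply: tE; rewrite (leq_ltn_trans km) // dE.
Qed.

(** Both sides are linear in [p] and satisfy Leibniz's rule, so it suffices to compare them on [1]
    and on the variables. *)
Lemma derivation_mpoly_cps (D : O -> O) p :
  {morph D : F G / F + G} -> (forall x F, D (x *: F) = x *: D F) ->
  (forall F G, D (F * G) = D F * G + F * D G) ->
  D (mpoly_cps p) = \sum_i mpoly_cps p^`M(i) * D (mpoly_cps 'X_i).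
Proof.
move=> DD DZ DM.
have D1 : D 1 = 0.
  have := DM 1 1; rewrite !mulr1 mul1r => /eqP.
  by rewrite -subr_eq0 opprD addrA subrr sub0r oppr_eq0 => /eqP.
pose E q := D (mpoly_cps q) = \sum_i mpoly_cps q^`M(i) * D (mpoly_cps 'X_i).
have EM q r : E q -> E r -> E (q * r).
  rewrite /E rmorphM DM => -> ->; rewrite mulr_suml mulr_sumr -big_split.
  apply: eq_bigr => i _; rewrite /= mderivM rmorphD !rmorphM mulrDl mulrA; congr (_ + _).
  by rewrite mulrAC.
have E1 : E 1.
  rewrite /E rmorph1 D1 big1 // => i _.
  by rewrite -mpolyC1 mderivC linear0 mul0r.
have EX i : E 'X_i.
  have UU : (U_(i) - U_(i))%MM = 0%MM :> 'X_{1..n}.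
    by apply/mnmP => k; rewrite mnmBE subnn mnm0E.
  rewrite /E (bigD1 i) //= mderivX mnm1E eqxx scale1r UU mpolyX0 rmorph1 mul1r.
  rewrite big1 ?addr0 // => j ji.
  by rewrite mderivX mnm1E eq_sym (negPf ji) scale0r linear0 mul0r.
rewrite -/(E p); elim/mpolyind: p => [|c m q _ _ Eq].
  by rewrite /E -(scale0r 0) linearZ DZ !scale0r big1 // => i _; rewrite !linear0 mul0r.
have EXm : E 'X_[m].
  rewrite mpolyXE_id; apply: (big_ind E) => // i _.
  by elim: (m i) => [|k IH] //; rewrite exprS; apply: (EM).
rewrite /E linearD linearZ DD DZ Eq EXm scaler_sumr -big_split.
by apply: eq_bigr => i _; rewrite /= mderivD mderivZ linearD linearZ mulrDl scalerAl.
Qed.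

(* The pullback [phi \o cps_deriv j \o psi] of a partial derivative is again a
   derivation, so it maps [q] into the ideal of the partial derivatives of [q]. *)
Lemma rmorph_deriv_tjurina (phi : {lrmorphism O -> O}) (psi : O -> O) u p q j :
  cancel phi psi -> cancel psi phi -> phi (mpoly_cps p) = u * mpoly_cps q ->
  exists (B : 'I_n -> O) C, phi (mpoly_cps p^`M(j)) =
    \sum_i B i * mpoly_cps q^`M(i) + C * mpoly_cps q.
Proof.
move=> phiK psiK pq; have inj := can_inj phiK.
pose D F := phi (cps_deriv j (psi F)).
have DD : {morph D : F G / F + G}.
  move=> F G; rewrite /D -rmorphD -cps_derivD; congr (phi (cps_deriv j _)).
  by apply: inj; rewrite [RHS]rmorphD !psiK; congr (_ + _); apply/esym/psiK.
have DZ x F : D (x *: F) = x *: D F.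
  rewrite /D -linearZ -cps_derivZ; congr (phi (cps_deriv j _)).
  by apply: inj; rewrite [RHS]linearZ psiK; congr (_ *: _); apply/esym/psiK.
have DM F G : D (F * G) = D F * G + F * D G.
  rewrite /D; have -> : psi (F * G) = psi F * psi G.
    by apply: inj; rewrite [RHS]rmorphM !psiK; congr (_ * _); apply/esym/psiK.
  by rewrite cps_derivM rmorphD !rmorphM; congr (_ * _ + _ * _); apply: psiK.
exists (fun i => u * D (mpoly_cps 'X_i)), (D u).
rewrite -cps_deriv_mpoly -[mpoly_cps p]phiK pq -/(D _) DM addrC; congr (_ + _).
rewrite derivation_mpoly_cps // mulr_sumr; apply: eq_bigr => i _.
by rewrite -mulrA [X in u * X]mulrC.
Qed.

End ConvergentSeries.

(** * Jets of the Tjurina ideals *)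

(** Choose [L] and [R] with L A R the identity of size [r]. The determinant of L (A + t B) R is a
    polynomial in t with value 1 at 0; away from its finitely many roots the rank is at least
    [r]. *)
Lemma rank_perturbation (K : closedFieldType) (p q : nat) (A B : 'M[K]_(p, q)) :
  exists s : seq K, forall t, t \notin s -> (\rank A <= \rank (A + t *: B)%R)%N.
Proof.
set r := \rank A.
have [L [R LAR]] : exists (L : 'M_(r, p)) (R : 'M_(q, r)), L *m A *m R = 1%:M.
  have /row_freeP[R hR] := row_base_free A.
  have /submxP[L hL] : (row_base A <= A)%MS by rewrite eq_row_base.
  by exists L, R; rewrite -hL.
pose C := L *m B *m R.
pose d : {poly K} := \det (1%:M + 'X *: map_mx polyC C).
have dE t : d.[t] = \det (L *m (A + t *: B) *m R).
  rewrite -[LHS]/(horner_eval t d) -det_map_mx mulmxDr mulmxDl LAR; congr (\det _).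
  rewrite -scalemxAr -scalemxAl -/C; apply/matrixP => i j; rewrite !mxE.
  rewrite rmorphD rmorphM /= /horner_eval hornerX hornerC.
  by case: eqP => _; rewrite ?mulr1n ?mulr0n ?hornerC.
have d0 : d != 0.
  apply/eqP => /(congr1 (horner^~ 0)); rewrite horner0 dE scale0r addr0 LAR det1.
  by move/eqP; rewrite oner_eq0.
have [s dP] := closed_field_poly_normal d; exists s => t ts.
have : d.[t] != 0.
  rewrite dP hornerZ mulf_eq0 lead_coef_eq0 (negPf d0) /= horner_prod.
  rewrite prodf_seq_neq0; apply/allP => z zs /=.
  by rewrite hornerXsubC subr_eq0; apply: contraNneq ts => ->.
rewrite dE -unitfE -unitmxE => /mxrank_unit e.
have := leq_trans (mxrankM_maxl (L *m (A + t *: B)) R) (mxrankM_maxr L _).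
by rewrite e.
Qed.

Section Truncation.
Variables (K : numFieldType) (n d : nat).
Local Notation O := (cpseries K n).
Local Notation M := 'X_{1..n < d.+1}.
Implicit Types (F G : O) (f p q : {mpoly K[n]}).

(** Series modulo order greater than [d], as row vectors: ideals become row spaces that can be
    compared by rank. *)
Definition jet F : 'rV[K]_#|{: M}| := \row_e F (enum_val e : M).

Lemma jetE F (m : 'X_{1..n}) (md : (mdeg m < d.+1)%N) :
  jet F 0 (enum_rank (BMultinom md)) = F m.
Proof. by rewrite mxE enum_rankK. Qed.

Lemma jet_is_linear : linear jet.
Proof. by move=> x F G; apply/rowP => e; rewrite !mxE. Qed.

HB.instance Definition _ := GRing.isLinear.Build K O 'rV[K]_#|{: M}| _ jet jet_is_linear.

Lemma jet_vanish F : vanish d.+1 F -> jet F = 0.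
Proof. by move=> hF; apply/rowP => e; rewrite !mxE hF // bmdeg. Qed.

Definition jet_poly F : {mpoly K[n]} := cps_trunc d.+1 F.

Lemma vanish_jet_poly F : vanish d.+1 (F - mpoly_cps (jet_poly F)).
Proof. by move=> m md; rewrite cpcoefD cpcoefN /= cps_truncE // subrr. Qed.

Definition jet_mx (phi : O -> O) : 'M[K]_#|{: M}| :=
  \matrix_e jet (phi (mpoly_cps 'X_[enum_val e : M])).

(** [F] and its jet polynomial differ by a series of order greater than [d], which [phi] maps to
    another such series. *)
Lemma jet_mxE (phi : {lrmorphism O -> O}) F : jet F *m jet_mx phi = jet (phi F).
Proof.
rewrite -[in RHS](subrK (mpoly_cps (jet_poly F)) F) rmorphD linearD /=.
rewrite (jet_vanish (vanish_rmorph phi (vanish_jet_poly F))) add0r.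
have -> : phi (mpoly_cps (jet_poly F)) =
    \sum_(m : M) F m *: phi (mpoly_cps 'X_[m]).
  rewrite /jet_poly /cps_trunc (linear_sum (@mpoly_cps K n)) linear_sum.
  by apply: eq_bigr => m _; rewrite -linearZ; congr (phi _); rewrite linearZ.
rewrite mulmx_sum_row linear_sum (reindex enum_rank (onW_bij _ (enum_rank_bij _))).
by apply: eq_bigr => m _; rewrite linearZ rowK mxE enum_rankK.
Qed.

(** The matrix of the inverse automorphism is a right inverse. *)
Lemma jet_mx_free (phi : {lrmorphism O -> O}) : bijective phi -> row_free (jet_mx phi).
Proof.
case=> psi phiK psiK.
pose psiL := GRing.isLinear.Build K O O _ psi (GRing.can2_linear phiK psiK).
pose psiM := GRing.isMonoidMorphism.Build O O psi (GRing.can2_monoid_morphism phiK psiK).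
pose psi' : {lrmorphism O -> O} := HB.pack psi psiL psiM.
apply/row_freeP; exists (jet_mx psi'); apply/row_matrixP => e.
rewrite row_mul rowK jet_mxE /= phiK row1.
by apply/rowP => e'; rewrite !mxE /= mcoeffX -bmeqP (inj_eq enum_val_inj) eq_sym.
Qed.

(** The row space is the Jacobian ideal of [p] modulo order greater than [d]. Generators are listed
    rather than a basis, which makes the matrix linear in [p]. *)
Definition jacobian_jets p : 'M[K]_(#|{: 'I_n * M}|, #|{: M}|) :=
  \matrix_r jet (mpoly_cps
    ('X_[(enum_val r : 'I_n * M).2] * p^`M((enum_val r : 'I_n * M).1))).

Lemma jacobian_jets_is_linear : linear jacobian_jets.
Proof.
move=> x p q; apply/row_matrixP => r; rewrite linearD linearZ /= !rowK.
by rewrite mderivD mderivZ mulrDr -scalerAr !linearD /= !linearZ.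
Qed.

HB.instance Definition _ :=
  GRing.isLinear.Build K {mpoly K[n]} 'M[K]_(#|{: 'I_n * M}|, #|{: M}|) _
  jacobian_jets jacobian_jets_is_linear.

(** Truncating each [B i] at degree [d] changes the sum only in order greater than [d]. *)
Lemma jet_sub_jacobian_jets p (B : 'I_n -> O) :
  (jet (\sum_i B i * mpoly_cps p^`M(i))%R <= jacobian_jets p)%MS.
Proof.
rewrite linear_sum; apply: summx_sub => i _ /=.
rewrite -(subrK (mpoly_cps (jet_poly (B i))) (B i)) mulrDl linearD /=.
rewrite jet_vanish; last first.
  by rewrite -[d.+1]addn0; apply: vanishM => //; apply: vanish_jet_poly.
rewrite add0r -rmorphM /= /jet_poly /cps_trunc mulr_suml.
rewrite (linear_sum (@mpoly_cps K n)) linear_sum.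
apply: summx_sub => m _; rewrite -scalerAl linearZ /= linearZ /=.
apply: scalemx_sub.
suff -> : jet (mpoly_cps ('X_[m] * p^`M(i))) =
    row (enum_rank (i, m)) (jacobian_jets p) by apply: row_sub.
by rewrite rowK enum_rankK.
Qed.

(** A combination of the rows is the jet of some [q] in the Jacobian ideal. As [p] and [q] agree up
    to degree [d], [p] is the component of [q] in degree [d], and the ideal is homogeneous. *)
Lemma jacobian_jets_homog k f p : f \is k.+1.-homog -> p \is d.-homog ->
  (jet (mpoly_cps p) <= jacobian_jets f)%MS -> jacobian_ideal f p.
Proof.
move=> hf hp /submxP[v hv].
pose q := \sum_r v 0 r *:
  ('X_[(enum_val r : 'I_n * M).2] * f^`M((enum_val r : 'I_n * M).1)).
have Jq : jacobian_ideal f q.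
  have [J0 JD JM] := ideal_gen_ideal (fun i : 'I_n => f^`M(i)).
  apply: ideal_sum; first exact: ideal_gen_ideal.
  move=> r _; rewrite -mul_mpolyC; apply: (JM); apply: (JM).
  exact: (mem_ideal_gen (fun i : 'I_n => f^`M(i))).
suff -> : p = pihomog mdeg d q.
  by apply: (@ideal_gen_pihomog _ _ _ _ k) => // i; apply: mderiv_homog.
rewrite -[LHS](pihomog_dE hp); apply/eqP; rewrite -subr_eq0 -pihomogB.
have jpq : jet (mpoly_cps (p - q)) = 0.
  rewrite linearB /= linearB /=; apply/eqP; rewrite subr_eq0 hv mulmx_sum_row /q.
  rewrite (linear_sum (@mpoly_cps K n)) linear_sum; apply/eqP/eq_bigr => r _.
  by rewrite rowK linearZ /= linearZ.
rewrite pihomogE big1_seq // => m /andP[/eqP md _].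
have md' : (mdeg m < d.+1)%N by rewrite md.
by rewrite -[_@_m]/(mpoly_cps (p - q) m) -(jetE _ md') jpq mxE scale0r.
Qed.

End Truncation.

(** * Regular forms and the comparison of ranks *)

(** Otherwise the partial derivatives and x_i - 1 would have a common zero by the Nullstellensatz;
    by Euler's formula [f] vanishes there too, so it would be a singular point. *)
Lemma smooth_jacobian_power (R : realType) (n k : nat) (f : {mpoly R[i][n]}) i :
  f \is k.+1.-homog -> smooth_hypersurface f ->
  exists N, jacobian_ideal f ('X_i ^+ N).
Proof.
move=> hf smooth; have IJ := ideal_gen_ideal (fun i : 'I_n => f^`M(i)).
have [|J1] := pselect (adjoin (jacobian_ideal f) ('X_i - 1%:MP) 1).
  by apply: (@ideal_gen_power _ _ _ _ k) => j; apply: mderiv_homog.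
have [x hx] := proper_ideal_zero (@complex_uncountable R) (adjoin_ideal _ IJ) J1.
have fx j : f^`M(j).@[x] = 0.
  by apply: hx; apply: sub_adjoin; apply: (mem_ideal_gen (fun i : 'I_n => f^`M(i))).
have [||j] := smooth x; last by rewrite fx eqxx.
  exists i; have := hx _ (mem_adjoin ('X_i - 1%:MP) IJ).
  by rewrite mevalB mevalXU mevalC => /eqP; rewrite subr_eq0 => /eqP ->; rewrite oner_eq0.
have /(congr1 (meval x)) := mderiv_euler hf.
rewrite mevalZ rmorph_sum big1 => [/esym/eqP|j _]; last by rewrite /= mevalM fx mul0r.
by rewrite mulf_eq0 pnatr_eq0 => /eqP.
Qed.

Lemma mpoly_cps_euler (K : numFieldType) (n k : nat) (f : {mpoly K[n]}) :
  f \is k.+1.-homog -> ideal_gen (fun i => mpoly_cps f^`M(i)) (mpoly_cps f).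
Proof.
move=> hf; exists (fun i => mpoly_cps (k.+1%:R^-1 *: 'X_i)).
have k0 : (k.+1%:R : K) != 0 by rewrite pnatr_eq0.
rewrite -[in LHS](scalerK k0 f) -mderiv_euler // scaler_sumr rmorph_sum.
by apply: eq_bigr => i _; rewrite -rmorphM -scalerAl mulrC.
Qed.

Theorem mainTheorem3 (R : realType) (n m : nat) (hn : (2 <= n)%N)
  (hm : (3 <= m)%N) (h3 : m = 3%N -> (4 <= n)%N) (h4 : m = 4%N -> (3 <= n)%N)
  (f : {mpoly R[i][n]}) (f_homog : f \is m.-homog)
  (f_regular : smooth_hypersurface f) :
  exists s : seq R[i], forall t : R[i], t \notin s ->
    ~ analytically_equivalent (mpoly_cps (f + t *: Hess f)) (mpoly_cps f).
Proof.
case: m hm h3 h4 f_homog => [|[|k]] // hm h3 h4 hf.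
pose H := Hess f; have hH : H \is (n * k).-homog := Hess_homog hf.
(* With m = k + 2: n > 3 for k = 1, 2n > 4 for k = 2, and nk >= 2k > k + 2 for k >= 3. *)
have deg_neq : (n * k != k.+2)%N.
  case: k hm h3 h4 {hf H hH} => [|[|[|k]]] // _ h3 h4.
  - by rewrite muln1 gtn_eqF // h3.
  - by rewrite gtn_eqF // (leq_trans _ (leq_mul (h4 erefl) (leqnn 2))).
  - rewrite gtn_eqF // (leq_trans _ (leq_mul hn (leqnn _))) //.
    by rewrite mul2n -addnn -[X in (X < _)%N]addn2 ltn_add2l.
(* Jets are taken to order [n * k], the degree of [H]. The row of [H] is fixed and the block below
   is linear in [p], so [A (f + t *: H)] is a linear perturbation of [A f]. *)
pose A p := col_mx (jet (n * k) (mpoly_cps H)) (jacobian_jets (n * k) p).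
have rankA0 : (\rank (jacobian_jets (n * k) f) < \rank (A f))%N.
  have : (jacobian_jets (n * k) f < A f)%MS.
    rewrite ltmxE; apply/andP; split.
      by rewrite -addsmxE addsmxSr.
    apply/negP => /(submx_trans _) h.
    have /(jacobian_jets_homog hf hH) :
        (jet (n * k) (mpoly_cps H) <= jacobian_jets (n * k) f)%MS.
      by apply: h; rewrite -addsmxE addsmxSl.
    apply: (Hess_notin_jacobian hf) => i; exact: smooth_jacobian_power hf f_regular.
  by rewrite ltmxErank => /andP[].
have [s hs] := rank_perturbation (A f) (col_mx 0 (jacobian_jets (n * k) H)).
(* The value 0 is excluded because [H] is recovered from [g] by dividing by [t]. *)
exists (0 :: s) => t; rewrite inE negb_or => /andP[t0 /hs rankAt].
case=> phi phi_bij [u _ phi_g].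
pose g := f + t *: H; rewrite -/H -/g in phi_g.
have AtE : A f + t *: col_mx 0 (jacobian_jets (n * k) H) = A g.
  by rewrite /A linearD linearZ /= scale_col_mx add_col_mx scaler0 addr0.
rewrite AtE in rankAt.
(* By Euler's formula [J] contains [f], so it is the whole Tjurina ideal of [f]. *)
pose J := ideal_gen (fun i => mpoly_cps f^`M(i)).
have IJ : is_ideal J := ideal_gen_ideal _; have [_ JD JM] := IJ.
have Jf : J (mpoly_cps f) := mpoly_cps_euler hf.
have Jphi_g0 : J (phi (mpoly_cps g)) by rewrite phi_g; apply: (JM).
have Jphi_g j : J (phi (mpoly_cps g^`M(j))).
  case: phi_bij => psi phiK psiK.
  have [B [C ->]] := rmorph_deriv_tjurina j phiK psiK phi_g.
  by apply: JD; [exists B | apply: JM].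
have Jphi_H : J (phi (mpoly_cps H)).
  (* Euler's formula, in degree m for [f] and nk for [H], leaves t (nk - m) H. *)
  pose c : R[i] := t * ((n * k)%:R - k.+2%:R).
  have c0 : c != 0 by rewrite mulf_neq0 // subr_eq0 eqr_nat.
  have cH : \sum_i g^`M(i) * 'X_i - k.+2%:R *: g = c *: H.
    under eq_bigr do rewrite mderivD mderivZ mulrDl -scalerAl.
    rewrite big_split -scaler_sumr /= (mderiv_euler hf) (mderiv_euler hH) /g.
    rewrite scalerDr opprD addrACA subrr add0r.
    by rewrite !scalerA -scalerBl [_ * t]mulrC -mulrBr.
  rewrite -(scalerK c0 H) -cH; set q := _ - _.
  have -> : phi (mpoly_cps (c^-1 *: q)) = c^-1%:A * phi (mpoly_cps q).
    by rewrite mulr_algl linearZ /= linearZ.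
  apply: (JM); rewrite /q -mul_mpolyC !rmorphB; apply: (JD).
    rewrite !rmorph_sum; apply: ideal_sum => // i _.
    by rewrite !rmorphM mulrC; exact: (JM _ _ (Jphi_g i)).
  by apply: ideal_opp => //; rewrite !rmorphM; exact: (JM _ _ Jphi_g0).
have : (A g *m jet_mx (n * k) phi <= jacobian_jets (n * k) f)%MS.
  rewrite mul_col_mx col_mx_sub; apply/andP; split.
    by rewrite jet_mxE; have [B ->] := Jphi_H; apply: jet_sub_jacobian_jets.
  apply/row_subP => r; rewrite row_mul rowK jet_mxE; set Xg := _ * _.
  have : J (phi (mpoly_cps Xg)) by rewrite !rmorphM; exact: (JM _ _ (Jphi_g _)).
  by case=> B ->; apply: jet_sub_jacobian_jets.
(* Since [phi] acts injectively on jets, the rank of [A g] is at most that of the jets of [J], which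
   is less than the rank of [A f], itself at most that of [A g]. *)
move/mxrankS; rewrite mxrankMfree ?jet_mx_free // => rankAg.
by have := leq_ltn_trans (leq_trans rankAt rankAg) rankA0; rewrite ltnn.
Qed.
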